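(* Let $k\ge 2$, let $H_1$ be a graph with vertex set $[k]$ and $H_2$ a graph with vertex set $[2]^k$. If $H_2$ is $H_1$-minimal, then $$2^{k-\min\{d_i\mid i\in[k]\}-1}\le |E(H_2)|\le\sum_{i=1}^k2^{k-d_i-1},$$ where $d_i$ is the degree of the vertex $i$ in $H_1$.
   Context: All graphs are finite and simple. $[k]=\{1,\dots,k\}$; $[2]^k$ is the set of vectors $x=(x_{(1)},\dots,x_{(k)})$ with entries in $\{1,2\}$. For a graph $F$ and $S\subseteq V(F)$, $\mathcal E(F,S)$ is the set of all $S$-coverings in $F$, i.e. sets $E\subseteq E(F)$ such that every vertex of $S$ is incident to at least one edge of $E$. For a graph $H_1$ on $[k]$ and a graph $H_2$ on $[2]^k$, $H_1\circ H_2$ is the graph on the disjoint union $[k]\sqcup[2]^k$ with edge set $E(H_1)\cup E(H_2)\cup\{\{i,x\}: i\in[k],\ x\in[2]^k,\ x_{(i)}=1\}$. For a set $E$ of 2-subsets of $[2]^k$, $span(E)$ is the graph with vertex set $[2]^k$ and edge set $E$. For $I\subseteq[k]$ let $[2]^k_I(2)=\{x\in[2]^k: x_{(i)}=2\ \forall i\in I\}$. For $i\in[k]$ let $B^k_i$ be the complete bipartite graph with parts $\{x\in[2]^k:x_{(i)}=1\}$ and $\{x\in[2]^k:x_{(i)}=2\}$. For a graph $H_1$ on $[k]$, $H_1(i)$ is the union of $\{i\}$ and the set of neighbours of $i$ in $H_1$. Define $$\mathcal B_k=\Big\{H_1\circ span\Big(\bigcup_{i\in[k]}E_i\Big): H_1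 \text{ a graph on } [k],\ E_i\in\mathcal E(B^k_i,[2]^k_{H_1(i)}(2))\ \text{for each } i\in[k]\Big\}.$$ $H_2$ is called $H_1$-minimal if $H_1\circ H_2\in\mathcal B_k$ and $H_1\circ H_2'\notin\mathcal B_k$ for every spanning subgraph $H_2'$ of $H_2$ with $H_2'\ne H_2$ (same vertex set $[2]^k$, edge set properly contained in $E(H_2)$). *)

(* Defs.v *)
From mathcomp Require Import all_boot.

Set Implicit Arguments.
Unset Strict Implicit.
Unset Printing Implicit Defensive.

Definition two_subsets (T : finType) (E : {set {set T}}) : bool :=
  [forall e in E, #|e| == 2].

(* A simple graph whose vertex set is the whole of [T]. *)
Record sgraph (T : finType) := SGraph {
  edges : {set {set T}};
  edgesP : two_subsets edges
}.

Section Graphs.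

Variable T : finType.

Lemma edges_inj : injective (@edges T).
Proof.
move=> [E EP] [F FP] /= eqEF; case: F / eqEF FP => FP.
by rewrite (bool_irrelevance EP FP).
Qed.

Lemma two_subsets_sep (E : {set {set T}}) :
  two_subsets [set e in E | #|e| == 2].
Proof. by apply/forall_inP => e; rewrite inE => /andP[]. Qed.

(* To be total, [span] discards the members of [E] that are not 2-subsets;
   by [edges_span] this has no effect on a set of 2-subsets. *)
Definition span (E : {set {set T}}) : sgraph T := SGraph (two_subsets_sep E).

Lemma edges_span (E : {set {set T}}) : two_subsets E -> edges (span E) = E.
Proof.
move=> /forall_inP EP; apply/setP => e; rewrite inE.
by case: (boolP (e \in E)) => //= /EP ->.
Qed.

Definition neighbors (G : sgraph T) (v : T) : {set T} :=
  [set u | [set v; u] \in edges G].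

Definition closed_neighbors (G : sgraph T) (v : T) : {set T} :=
  v |: neighbors G v.

Definition degree (G : sgraph T) (v : T) : nat := #|neighbors G v|.

(* Every degree is smaller than #|T| (lemma [degree_lt]), so the default
   value #|T| is only returned when [T] is empty. *)
Definition min_degree (G : sgraph T) : nat :=
  \big[minn/#|T|]_(v : T) degree G v.

Lemma degree_lt (G : sgraph T) (v : T) : degree G v < #|T|.
Proof.
rewrite -cardsT; apply: proper_card; apply/properP; split; first exact: subsetT.
exists v; rewrite ?inE //; apply/negP => vE.
by have /forall_inP/(_ _ vE) := edgesP G; rewrite setUid cards1.
Qed.

Definition coverings (G : sgraph T) (S : {set T}) : {set {set {set T}}} :=
  [set E : {set {set T}} | (E \subset edges G)
     && [forall x in S, [exists e in E, x \in e]]].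

(* Meant for disjoint [A] and [B]. *)
Definition complete_bipartite (A B : {set T}) : sgraph T :=
  span [set [set x; y] | x in A, y in B].

End Graphs.

(* [2]^k, and the two values of a coordinate: the paper's 1 and 2 are the
   elements 0 and 1 of 'I_2. Likewise [k] is 'I_k, numbered from 0. *)
Notation cube k := {ffun 'I_k -> 'I_2}.
Definition one : 'I_2 := ord0.
Definition two : 'I_2 := ord_max.

Section Construction.

Variable k : nat.

Definition layer (i : 'I_k) (v : 'I_2) : {set cube k} :=
  [set x : cube k | x i == v].

Definition circ_edges (H1 : sgraph 'I_k) (H2 : sgraph (cube k)) :
    {set {set 'I_k + cube k}} :=
  [set inl @: e | e : {set 'I_k} in edges H1]
  :|: [set inr @: e | e : {set cube k} in edges H2]
  :|: [set [set inl i; inr x] | i : 'I_k, x : cube k in layer i one].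

Lemma circ_edgesP (H1 : sgraph 'I_k) (H2 : sgraph (cube k)) :
  two_subsets (circ_edges H1 H2).
Proof.
apply/forall_inP => e; rewrite !inE => /orP[/orP[]|].
- case/imsetP => e' e'E ->; rewrite card_imset; last by move=> ? ? [].
  exact: (forall_inP (edgesP H1)).
- case/imsetP => e' e'E ->; rewrite card_imset; last by move=> ? ? [].
  exact: (forall_inP (edgesP H2)).
- by case/imset2P => i x _ _ ->; rewrite cards2.
Qed.

Definition circ (H1 : sgraph 'I_k) (H2 : sgraph (cube k)) :
  sgraph ('I_k + cube k)%type := SGraph (circ_edgesP H1 H2).

Definition all_two (I : {set 'I_k}) : {set cube k} :=
  [set x : cube k | [forall i in I, x i == two]].

Definition Bi (i : 'I_k) : sgraph (cube k) :=
  complete_bipartite (layer i one) (layer i two).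

Definition in_B (G : sgraph ('I_k + cube k)%type) : Prop :=
  exists (H1 : sgraph 'I_k) (E : 'I_k -> {set {set cube k}}),
    (forall i, E i \in coverings (Bi i) (all_two (closed_neighbors H1 i)))
    /\ G = circ H1 (span (\bigcup_i E i)).

Definition minimal_for (H1 : sgraph 'I_k) (H2 : sgraph (cube k)) : Prop :=
  in_B (circ H1 H2) /\
  forall H2' : sgraph (cube k),
    edges H2' \proper edges H2 -> ~ in_B (circ H1 H2').

End Construction.

(* Main.v *)
Require Import Defs.
From mathcomp Require Import all_boot.

Set Implicit Arguments.
Unset Strict Implicit.
Unset Printing Implicit Defensive.

(** Every edge of [B_i] has exactly one end in layer 2 of the coordinate [i],
    and the set [S_i] to be covered by [E_i] lies in that layer; so
    [|S_i| <= |E_i|], where [|S_i| = 2 ^ (k - d_i - 1)].  This holds for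
    every [i], whence the lower bound.  Conversely, choosing in [E_i] one edge
    at each vertex of [S_i] yields a covering of size at most [|S_i|], and by
    minimality the union of these coverings is all of [E(H_2)]. *)

Section Coverings.

Variables (T : finType) (G : sgraph T) (S : {set T}).
Implicit Types (E : {set {set T}}).

Lemma edge_neq0 (e : {set T}) : e \in edges G -> e != set0.
Proof.
by move=> eG; rewrite -card_gt0 (eqP (forall_inP (edgesP G) _ eG)).
Qed.

Lemma two_subsetsS E : E \subset edges G -> two_subsets E.
Proof.
move=> /subsetP sEG; apply/forall_inP => e /sEG.
exact: (forall_inP (edgesP G)).
Qed.

(** The default [set0] is never taken when [E] is a covering of [S] and [x] lies in [S]. *)
Definition covering_edge E (x : T) : {set T} :=
  odflt set0 [pick e in E | x \in e].

Lemma covering_edgeP E x : E \in coverings G S -> x \in S ->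
  covering_edge E x \in E /\ x \in covering_edge E x.
Proof.
rewrite inE => /andP[_ /forall_inP cov] /cov /exists_inP[e eE xe].
rewrite /covering_edge; case: pickP => [e' /andP[]|/(_ e)] //=.
by rewrite eE xe.
Qed.

Lemma covering_edges_sub E :
  E \in coverings G S -> covering_edge E @: S \subset E.
Proof.
move=> EP; apply/subsetP => _ /imsetP[x xS ->].
by have [] := covering_edgeP EP xS.
Qed.

Lemma covering_edges_covering E :
  E \in coverings G S -> covering_edge E @: S \in coverings G S.
Proof.
move=> EP; rewrite inE (subset_trans (covering_edges_sub EP)) /=; last first.
  by move: EP; rewrite inE => /andP[].
apply/forall_inP => x xS; apply/exists_inP; exists (covering_edge E x).
  exact: imset_f.
by have [] := covering_edgeP EP xS.
Qed.

(** A chosen edge contains at most one vertex of [S], so distinct vertices of [S] get distinct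
    edges: [covering_edge E] is injective on [S] with values in [E]. *)
Lemma leq_card_covering E : {in edges G, forall e, #|e :&: S| <= 1} ->
  E \in coverings G S -> #|S| <= #|E|.
Proof.
move=> G1 EP; rewrite -(@card_in_imset _ _ (covering_edge E)).
  exact: subset_leq_card (covering_edges_sub EP).
move=> x y xS yS exy; have [xE xx] := covering_edgeP EP xS.
have [_ yy] := covering_edgeP EP yS.
have : covering_edge E x \in edges G.
  by move: EP; rewrite inE => /andP[/subsetP/(_ _ xE)].
by move/G1/card_le1_eqP; apply; rewrite inE ?xS ?yS ?xx ?exy ?yy.
Qed.

End Coverings.

Section Circ.

Variable k : nat.
Implicit Types (H : sgraph 'I_k) (G : sgraph (cube k)).

(** A point of [e] rules out an edge of the [inr] part, and a mixed edge has an [inr] end, which no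
    image under [inl] contains. *)
Lemma inl_circ_edges H G (e : {set 'I_k}) :
  e != set0 -> (inl @: e \in circ_edges H G) = (e \in edges H).
Proof.
case/set0Pn => a ae; rewrite !inE; apply/idP/idP; last first.
  by move=> eH; rewrite imset_f.
have ine : @inl _ (cube k) a \in inl @: e by rewrite imset_f.
case/orP => [/orP[]|].
- by case/imsetP => e' He' /(imset_inj (fun x y => @inl_inj _ _ x y)) ->.
- by case/imsetP => e' He' E; move: ine; rewrite E => /imsetP[].
- case/imset2P => i x _ _ E.
  have : inr x \in [set inl i; inr x] by rewrite !inE eqxx orbT.
  by rewrite -E => /imsetP[].
Qed.

Lemma inr_circ_edges H G (e : {set cube k}) :
  e != set0 -> (inr @: e \in circ_edges H G) = (e \in edges G).
Proof.
case/set0Pn => a ae; rewrite !inE; apply/idP/idP; last first.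
  by move=> eG; rewrite imset_f ?orbT.
have ine : @inr 'I_k _ a \in inr @: e by rewrite imset_f.
case/orP => [/orP[]|].
- by case/imsetP => e' He' E; move: ine; rewrite E => /imsetP[].
- by case/imsetP => e' He' /(imset_inj (fun x y => @inr_inj _ _ x y)) ->.
- case/imset2P => i x _ _ E.
  have : inl i \in [set inl i; inr x] by rewrite !inE eqxx.
  by rewrite -E => /imsetP[].
Qed.

(** [in_B] only provides some pair of factors; injectivity forces the first one to be the given
    [H1], so that the degrees in the bounds are the right ones. *)
Lemma circ_inj H H' G G' : circ H G = circ H' G' -> H = H' /\ G = G'.
Proof.
move=> /(congr1 (@edges _)) /= E; split; apply: edges_inj; apply/setP => e.
- have [->|e0] := eqVneq e set0; last first.
    by rewrite -(inl_circ_edges H G) // E inl_circ_edges.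
  by apply/idP/idP => /edge_neq0; rewrite eqxx.
- have [->|e0] := eqVneq e set0; last first.
    by rewrite -(inr_circ_edges H G) // E inr_circ_edges.
  by apply/idP/idP => /edge_neq0; rewrite eqxx.
Qed.

Lemma card_all_two (I : {set 'I_k}) : #|all_two I| = 2 ^ (k - #|I|).
Proof.
have -> : k - #|I| = #|~: I| by rewrite [RHS]cardsCs setCK card_ord.
(* The vectors are counted as the functions that may differ from [two] only on the complement of
   [I], where their values are free. *)
rewrite -[in RHS](card_ord 2) -(card_pffun_on two); apply: eq_card => x.
rewrite inE; apply/forall_inP/pffun_onP => [xI|[/supportP xI _] i iI].
  by split=> //; apply/supportP => i; rewrite inE negbK => /xI/eqP.
by rewrite xI // inE iI.
Qed.

(** There are no loops, so [i] is not its own neighbor and its closed neighborhood has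
    [degree H i + 1] elements. *)
Lemma card_all_two_closed H i :
  #|all_two (closed_neighbors H i)| = 2 ^ (k - degree H i - 1).
Proof.
rewrite card_all_two cardsU1 inE setUid addnC subnDA.
case: (boolP ([set i] \in edges H)) => //.
by move/(forall_inP (edgesP H)); rewrite cards1.
Qed.

Lemma Bi_all_two i (I : {set 'I_k}) : i \in I ->
  {in edges (Bi i), forall e, #|e :&: all_two I| <= 1}.
Proof.
move=> iI e; rewrite inE => /andP[/imset2P[x y]].
rewrite !inE => /eqP xi _ -> _.
apply: leq_trans (_ : #|[set y]| <= 1); last by rewrite cards1.
apply/subset_leq_card/subsetP => z; rewrite !inE => /andP[/orP[/eqP->|//]].
by move/forall_inP/(_ i iI); rewrite xi.
Qed.

(** Edges of [Bi i] are 2-subsets, so [span] discards nothing from a union of coverings. *)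
Lemma edges_span_coverings (S : 'I_k -> {set cube k}) E :
  (forall i, E i \in coverings (Bi i) (S i)) ->
  edges (span (\bigcup_i E i)) = \bigcup_i E i.
Proof.
move=> EP; apply: edges_span; apply/forall_inP => e /bigcupP[i _].
have : E i \subset edges (Bi i) by have:= EP i; rewrite inE => /andP[].
by move/two_subsetsS/forall_inP; apply.
Qed.

End Circ.

Theorem theorem4p6 (k : nat) (hk : 2 <= k)
    (H1 : sgraph 'I_k) (H2 : sgraph (cube k)) (hmin : minimal_for H1 H2) :
  2 ^ (k - min_degree H1 - 1) <= #|edges H2|
  /\ #|edges H2| <= \sum_(i < k) 2 ^ (k - degree H1 i - 1).
Proof.
case: hmin => -[H1' [E [EP /circ_inj[eH eG]]]] min; subst H1'.
have edgesE : edges H2 = \bigcup_i E i by rewrite eG (edges_span_coverings EP).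
have lower i : 2 ^ (k - degree H1 i - 1) <= #|edges H2|.
  rewrite -card_all_two_closed edgesE.
  apply: leq_trans (leq_card_covering _ (EP i)) _.
    by apply: Bi_all_two; rewrite setU11.
  exact/subset_leq_card/bigcup_sup.
split.
  (* The bound passes to the minimum because [minn] returns one of its arguments. The default value
     [k] of the big operator gives the exponent 0, so it remains to see that [H2] has an edge:
     [lower] at any vertex shows this, and [hk] supplies the vertex with index 1. *)
  rewrite /min_degree; elim/big_ind: _ => // [|m n].
    rewrite card_ord subnn; apply: leq_trans (lower (Ordinal hk)).
    by rewrite expn_gt0.
  by rewrite /minn; case: ifP.
pose S i := all_two (closed_neighbors H1 i).
pose F i := covering_edge (E i) @: S i.
have FP i : F i \in coverings (Bi i) (S i).
  exact: covering_edges_covering (EP i).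
have sub : \bigcup_i F i \subset edges H2.
  rewrite edgesE; apply/bigcupsP => i _.
  exact: subset_trans (covering_edges_sub (EP i)) (bigcup_sup i _).
have {}sub : edges H2 \subset \bigcup_i F i.
  (* Otherwise the span of the chosen edges would be a proper spanning subgraph of [H2], with [H1]
     and [F] witnessing [in_B]. *)
  apply/negPn/negP => nsub; case: (min (span (\bigcup_i F i))).
    by rewrite (edges_span_coverings FP) properE sub.
  by exists H1, F.
apply: leq_trans (subset_leq_card sub) _.
apply: (@leq_trans (\sum_i #|F i|)).
  elim/big_rec2: _ => [|i m A _ leA]; first by rewrite cards0.
  by apply: leq_trans (leq_card_setU _ _) _; rewrite leq_add2l.
by apply: leq_sum => i _; rewrite -card_all_two_closed leq_imset_card.
Qed.
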